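(* Let $a,b\in\mathbb{N}^3$. There is an integer $N$ (depending on $a,b$) such that for every field $k$ whose characteristic is either zero or greater than $N$, the HN ideal $I$ of $k[x_1,x_2,x_3]$ attached to $a,b$ satisfies $\operatorname{rad}(I)=I$.
   Context: $\mathbb{N}$ denotes the positive integers. For a field $k$ and $a=(a_1,a_2,a_3),b=(b_1,b_2,b_3)\in\mathbb{N}^3$, with $c=(c_1,c_2,c_3)=a+b$, the HN (Herzog-Northcott) ideal attached to $a,b$ is the ideal $I=(x_1^{c_1}-x_2^{b_2}x_3^{a_3},\ x_2^{c_2}-x_1^{a_1}x_3^{b_3},\ x_3^{c_3}-x_1^{b_1}x_2^{a_2})$ of the polynomial ring $k[x_1,x_2,x_3]$ in three variables. *)

(* Defs.v *)
From HB Require Import structures.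
From mathcomp Require Import all_boot all_order all_algebra.
From mathcomp Require Export mpoly.

Set Implicit Arguments.
Unset Strict Implicit.
Unset Printing Implicit Defensive.

Import GRing.Theory.
Local Open Scope ring_scope.

(* Ideals are Prop-valued subsets: membership in a generated ideal and in a
   radical is existential, and over an arbitrary [fieldType] it is not
   presented by a boolean predicate. *)

Definition ideal_gen (R : comNzRingType) (s : seq R) (f : R) : Prop :=
  exists u : 'I_(size s) -> R, f = \sum_(i < size s) u i * s`_i.

Definition radical (R : comNzRingType) (I : R -> Prop) (f : R) : Prop :=
  exists2 n : nat, (0 < n)%N & I (f ^+ n).

(* ['I_3] counts from 0: the variables x_1, x_2, x_3 are ['X_i1], ['X_i2],
   ['X_i3], and likewise for the entries of a and b. *)
Definition i1 : 'I_3 := @Ordinal 3 0 isT.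
Definition i2 : 'I_3 := @Ordinal 3 1 isT.
Definition i3 : 'I_3 := @Ordinal 3 2 isT.

Definition HN_gens (k : fieldType) (a b : 'I_3 -> nat) : seq {mpoly k[3]} :=
  let c i := (a i + b i)%N in
  [:: 'X_i1 ^+ c i1 - 'X_i2 ^+ b i2 * 'X_i3 ^+ a i3;
      'X_i2 ^+ c i2 - 'X_i1 ^+ a i1 * 'X_i3 ^+ b i3;
      'X_i3 ^+ c i3 - 'X_i1 ^+ b i1 * 'X_i2 ^+ a i2].

Definition HN_ideal (k : fieldType) (a b : 'I_3 -> nat) :
    {mpoly k[3]} -> Prop :=
  ideal_gen (HN_gens k a b).

Arguments HN_ideal : clear implicits.

(* [[pchar k]] is the set of primes [p] with [p%:R = 0] in [k]: it is empty in
   characteristic zero, and is the singleton of the characteristic otherwise. *)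
Definition char_zero_or_gt (k : fieldType) (N : nat) : Prop :=
  [pchar k] =i pred0 \/ exists2 p : nat, p \in [pchar k] & (N < p)%N.

(* Main.v *)
From HB Require Import structures.
Require Import Defs.
From mathcomp Require Import all_boot all_order all_algebra.
From mathcomp Require Import ssrcomplements zify ring.

Set Implicit Arguments.
Unset Strict Implicit.
Unset Printing Implicit Defensive.

Import GRing.Theory.
Local Open Scope ring_scope.

(** The three generators are binomials [X^v - X^w] whose exponent differences
    sum to zero and span a rank two lattice [L]; a short induction shows that
    [I] contains every [X^v - X^w] with [v - w] in [L].  Put
    [m = c2 c3 - a2 b3], [alpha = c3 u2 + a2 u3] and [beta = b3 u2 + c2 u3].
    By Cramer's rule, [u] lies in [L] iff [m] divides [alpha] and [beta], and
    [m u1 + a1 alpha + b1 beta = 0].  Recording these two residues and this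
    degree embeds [k[x1, x2, x3] / I] into the group algebra of [(Z/m)^2] over
    [k[t]].  That algebra has no element of square zero when [m] is invertible
    in [k]: multiplication by [f h^-1] has trace [m^2] times the coefficient of
    [f] at [h], while a matrix of square zero has trace zero. *)

(** * Square-zero elements of group algebras *)

(** In a rank factorization [A = C R], [C] cancels on the left and [R] on the right, so
    [C (R C) R = 0] forces [R C = 0]; and [R C] has the trace of [A]. *)
Lemma mxtrace_sqr0 (K : fieldType) (n : nat) (A : 'M[K]_n) :
  A *m A = 0 -> \tr A = 0.
Proof.
move=> AA0; rewrite -(mulmx_base A) mxtrace_mulC.
suff -> : row_base A *m col_base A = 0 by rewrite mxtrace0.
apply: (row_free_inj (row_base_free A)).
apply: (row_full_inj (col_base_full A)).
by rewrite mul0mx mulmx0 -(mulmxA (row_base A)) mulmxA !mulmx_base.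
Qed.

Lemma convolution_sqr0 (R : idomainType) (H : finZmodType) (F : H -> R) :
  #|H|%:R != 0 :> R -> (forall h, \sum_g F g * F (h - g) = 0) ->
  forall h, F h = 0.
Proof.
move=> cardH sqrF h.
(* Multiplication by [F] translated by [h], over a field so that traces apply; every diagonal entry
   is [F h]. *)
pose A : 'M[{fraction R}]_#|H| :=
  \matrix_(i, j) tofrac (F (h + enum_val j - enum_val i)).
have /mxtrace_sqr0 : A *m A = 0.
  apply/matrixP=> i j; rewrite !mxE.
  transitivity (\sum_(g : H)
    tofrac (F (h + g - enum_val i) * F (h + enum_val j - g))).
    rewrite [RHS](reindex (@enum_val _ predT)) /=; last first.
      by apply: onW_bij; apply: enum_val_bij.
    by apply: eq_bigr => l _; rewrite !mxE rmorphM.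
  rewrite -rmorph_sum /=.
  rewrite (reindex_inj (addrI (enum_val i - h))) /=.
  rewrite (eq_bigr (fun g => F g * F (h + h + enum_val j - enum_val i - g))).
    by rewrite -!addrA !addrA sqrF rmorph0.
  move=> g _; congr (F _ * F _).
    by rewrite addrA [h + _]addrC subrK addrAC subrr add0r.
  rewrite !opprD opprK !addrA; congr (_ - _).
  by rewrite addrAC [h + _ + h]addrAC.
rewrite /mxtrace (eq_bigr (fun=> tofrac (F h))); last first.
  by move=> i _; rewrite mxE addrK.
rewrite sumr_const card_ord -rmorphMn => /eqP; rewrite tofrac_eq0.
by rewrite -mulr_natr mulf_eq0 (negPf cardH) orbF => /eqP.
Qed.

(** * Ideals closed under square roots *)

Section GeneratedIdeal.
Variables (R : comNzRingType) (s : seq R).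

Lemma ideal_gen_nth i : (i < size s)%N -> ideal_gen s s`_i.
Proof.
move=> lt_is; exists (fun j => (j == Ordinal lt_is)%:R).
rewrite (bigD1 (Ordinal lt_is)) //= eqxx mul1r big1 ?addr0 // => j /negPf ->.
by rewrite mul0r.
Qed.

Lemma ideal_genM g f : ideal_gen s f -> ideal_gen s (g * f).
Proof.
case=> u ->; exists (fun i => g * u i).
by rewrite mulr_sumr; apply: eq_bigr => i _; rewrite mulrA.
Qed.

Lemma ideal_genD f g : ideal_gen s f -> ideal_gen s g -> ideal_gen s (f + g).
Proof.
move=> [u ->] [v ->]; exists (fun i => u i + v i).
by rewrite -big_split; apply: eq_bigr => i _; rewrite mulrDl.
Qed.

Lemma ideal_gen0 : ideal_gen s 0.
Proof. by exists (fun=> 0); rewrite big1 // => i _; rewrite mul0r. Qed.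

(** Since [n <= 2 ^ n], the power [f ^+ (2 ^ n)] is in the ideal; take [n] square roots. *)
Lemma ideal_gen_sqrt_closed :
  (forall g, ideal_gen s (g ^+ 2) -> ideal_gen s g) ->
  forall f, radical (ideal_gen s) f -> ideal_gen s f.
Proof.
move=> sqrt_closed f [n _ fnI].
have {fnI} : ideal_gen s (f ^+ (2 ^ n)).
  by rewrite -(subnK (ltnW (ltn_expl n (ltnSn 1)))) exprD; apply: ideal_genM.
elim: n => [|n IHn]; first by rewrite expn0 expr1.
by rewrite expnSr exprM => /sqrt_closed.
Qed.

End GeneratedIdeal.

(** * The map to the group algebra and its kernel *)

Section GroupAlgebraImage.
Variables (n : nat) (R : comNzRingType) (H : finZmodType).
Variables (cl : 'X_{1..n} -> H) (dg : 'X_{1..n} -> nat).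

(** Coefficient at [h] of the image of [p] in the group algebra of [H] over [{poly R}], where
    ['X_[u]] goes to ['X^(dg u)] times the group element [cl u]. *)
Definition class_part (h : H) (p : {mpoly R[n]}) : {poly R} :=
  \sum_(u <- msupp p | cl u == h) p@_u *: 'X^(dg u).

(** Gives several polynomials one common summation range. *)
Lemma class_partE d h p : (msize p <= d)%N ->
  class_part h p =
  \sum_(u : 'X_{1..n < d} | cl u == h) p@_u *: 'X^(dg u).
Proof.
move=> led; rewrite /class_part !(big_mkcond (fun _ => cl _ == h)) /=.
rewrite (big_mksub 'X_{1..n < d}) ?msupp_uniq //=; last first.
  by move=> u /msize_mdeg_lt /leq_trans; apply.
rewrite big_rmcond //= => j /memN_msupp_eq0 ->.
by rewrite scale0r if_same.
Qed.

Lemma class_part_is_linear h : linear (class_part h).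
Proof.
move=> c p q; pose d := maxn (msize (c *: p + q)) (maxn (msize p) (msize q)).
rewrite !(@class_partE d) ?leq_max ?leqnn ?orbT //.
rewrite scaler_sumr -big_split; apply: eq_bigr => u _ /=.
by rewrite mcoeffD mcoeffZ scalerDl scalerA.
Qed.

HB.instance Definition _ h :=
  GRing.isLinear.Build R {mpoly R[n]} {poly R} _ (class_part h)
    (class_part_is_linear h).

Lemma class_partX h u :
  class_part h 'X_[u] = if cl u == h then 'X^(dg u) else 0.
Proof.
by rewrite /class_part msuppX big_mkcond big_seq1 mcoeffX eqxx scale1r.
Qed.

Lemma coef_class_part d h p i : (msize p <= d)%N ->
  (class_part h p)`_i =
  \sum_(u : 'X_{1..n < d} | (cl u, dg u) == (h, i)) p@_u.
Proof.
move=> led; rewrite (class_partE _ led) coef_sum big_mkcond [RHS]big_mkcond.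
apply: eq_bigr => u _; rewrite xpair_eqE; case: eqP => //= _.
by rewrite coefZ coefXn eq_sym; case: eqP; rewrite ?mulr1 ?mulr0.
Qed.

Hypotheses (clD : {morph cl : u v / (u + v)%MM >-> u + v})
  (dgD : {morph dg : u v / (u + v)%MM >-> (u + v)%N}).

Lemma class_partM h p q :
  class_part h (p * q) = \sum_g class_part g p * class_part (h - g) q.
Proof.
rewrite {1}[p]mpolyE {1}[q]mpolyE mulr_suml linear_sum /=.
under [RHS]eq_bigr
  do rewrite [X in class_part _ X * _]mpolyE linear_sum mulr_suml.
rewrite exchange_big; apply: eq_bigr => u _ /=.
rewrite mulr_sumr linear_sum /=.
under [RHS]eq_bigr
  do rewrite [X in _ * class_part _ X]mpolyE linear_sum mulr_sumr.
rewrite exchange_big; apply: eq_bigr => v _ /=.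
rewrite -scalerAl -scalerAr -mpolyXD !linearZ /= class_partX clD dgD.
under eq_bigr do rewrite !linearZ /= -scalerAl -scalerAr !class_partX.
rewrite (bigD1 (cl u)) //= big1 ?addr0 => [|g neg]; last first.
  by rewrite eq_sym (negPf neg) mul0r !scaler0.
rewrite eqxx [cl v == _]eq_sym subr_eq [h == _]eq_sym [cl v + _]addrC.
by case: eqP => _; rewrite ?exprD ?mulr0.
Qed.

Lemma class_part_binomial h p v w : cl v = cl w -> dg v = dg w ->
  class_part h (p * ('X_[v] - 'X_[w])) = 0.
Proof.
move=> eq_cl eq_dg; rewrite class_partM big1 // => g _.
by rewrite linearB /= !class_partX eq_cl eq_dg subrr mulr0.
Qed.

(** Each monomial is congruent to a representative of its class and degree; the coefficients sharing
    a representative add up to a coefficient of some [class_part], which is zero. *)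
Lemma class_part0_mem (s : seq {mpoly R[n]}) p :
  (forall v w, cl v = cl w -> dg v = dg w -> ideal_gen s ('X_[v] - 'X_[w])) ->
  (forall h, class_part h p = 0) -> ideal_gen s p.
Proof.
move=> binomials p0; pose d := msize p.
pose key (u : 'X_{1..n < d}) := (cl u, dg u).
(* The default is never reached, as [u] itself qualifies; so [rep u] depends only on [key u]. *)
pose rep u := odflt u [pick v | key v == key u].
have key_rep u : key (rep u) = key u.
  by rewrite /rep; case: pickP => [v /eqP|].
have repE u v : key u = key v -> rep u = rep v.
  rewrite /rep => ->; case: pickP => // /(_ v).
  by rewrite eqxx.
suff reps0 : \sum_(u : 'X_{1..n < d}) p@_u *: 'X_[rep u] = 0.
  have -> : p = \sum_(u : 'X_{1..n < d}) p@_u *: ('X_[u] - 'X_[rep u]).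
    under eq_bigr do rewrite scalerBr.
    by rewrite sumrB reps0 subr0 -mpolywE.
  elim/big_rec: _ => [|u f _ fI]; first exact: ideal_gen0.
  apply: ideal_genD => //; rewrite -mul_mpolyC; apply: ideal_genM.
  by have [eq_cl eq_dg] := key_rep u; apply: binomials.
rewrite (partition_big rep predT) //= big1 // => r _.
rewrite (eq_bigr (fun u : 'X_{1..n < d} => p@_u *: 'X_[r])); last first.
  by move=> u /eqP ->.
rewrite -scaler_suml.
case: (pickP (fun u => rep u == r)) => [u0 /eqP u0r|norep]; last first.
  by rewrite big_pred0 ?scale0r.
rewrite (eq_bigl (fun u => key u == key u0)) => [|u]; last first.
  by apply/eqP/eqP => [ur|/repE ->//]; rewrite -key_rep ur -u0r key_rep.
by rewrite -coef_class_part // p0 coef0 scale0r.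
Qed.

End GroupAlgebraImage.

(** * Lattice binomials lie in the ideal *)

Section LatticeCongruence.
Variables (R : comNzRingType) (J : R -> Prop) (x y z : R).
Hypotheses (J0 : J 0) (JD : forall f g, J f -> J g -> J (f + g))
  (JM : forall g f, J f -> J (g * f)).
Variables (a1 a2 a3 b1 b2 b3 : nat).
Hypotheses (Jx : J (x ^+ (a1 + b1) - y ^+ b2 * z ^+ a3))
  (Jy : J (y ^+ (a2 + b2) - x ^+ a1 * z ^+ b3))
  (Jz : J (z ^+ (a3 + b3) - x ^+ b1 * y ^+ a2)).

Let mon (u1 u2 u3 : nat) := x ^+ u1 * y ^+ u2 * z ^+ u3.
Let cg (f g : R) := J (f - g).

Let cg_trans f g h : cg f g -> cg g h -> cg f h.
Proof. by move=> fg gh; rewrite /cg -(subrKA g); apply: JD. Qed.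

Let cg_sym f g : cg f g -> cg g f.
Proof. by move=> fg; rewrite /cg -opprB -mulN1r; apply: JM. Qed.

Let cg_x u1 u2 u3 : cg (mon (a1 + b1 + u1) u2 u3) (mon u1 (b2 + u2) (a3 + u3)).
Proof.
rewrite /cg; have := JM (mon u1 u2 u3) Jx; congr J.
by rewrite /mon !exprD; ring.
Qed.

Let cg_y u1 u2 u3 : cg (mon u1 (a2 + b2 + u2) u3) (mon (a1 + u1) u2 (b3 + u3)).
Proof.
rewrite /cg; have := JM (mon u1 u2 u3) Jy; congr J.
by rewrite /mon !exprD; ring.
Qed.

Let cg_z u1 u2 u3 : cg (mon u1 u2 (a3 + b3 + u3)) (mon (b1 + u1) (a2 + u2) u3).
Proof.
rewrite /cg; have := JM (mon u1 u2 u3) Jz; congr J.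
by rewrite /mon !exprD; ring.
Qed.

(* The three moves sum to zero.  When exactly one of them, say the third, has
   multiplicity zero, the target monomial is divisible by z^(a3 + b3), and
   undoing the third move there lowers the other two multiplicities. *)
Lemma lattice_congruence (r s t u1 u2 u3 v1 v2 v3 : nat) :
  (u1 + s * a1 + t * b1 = v1 + r * (a1 + b1))%N ->
  (u2 + r * b2 + t * a2 = v2 + s * (a2 + b2))%N ->
  (u3 + r * a3 + s * b3 = v3 + t * (a3 + b3))%N ->
  J (x ^+ u1 * y ^+ u2 * z ^+ u3 - x ^+ v1 * y ^+ v2 * z ^+ v3).
Proof.
rewrite -/(mon u1 u2 u3) -/(mon v1 v2 v3) -/(cg _ _).
have [n] := ubnP (r + s + t)%N.
elim: n r s t u1 u2 u3 v1 v2 v3 => // n IHn.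
move=> [|r] [|s] [|t] u1 u2 u3 v1 v2 v3; rewrite ?mulSn ?mul0n => ltn e1 e2 e3.
- have [-> -> ->] : [/\ u1 = v1, u2 = v2 & u3 = v3] by split; lia.
  by rewrite /cg subrr.
- have -> : (u3 = a3 + b3 + (u3 - (a3 + b3)))%N by lia.
  apply: cg_trans (cg_z _ _ _) _.
  by apply: (IHn 0%N 0%N t); rewrite ?mul0n; lia.
- have -> : (u2 = a2 + b2 + (u2 - (a2 + b2)))%N by lia.
  apply: cg_trans (cg_y _ _ _) _.
  by apply: (IHn 0%N s 0%N); rewrite ?mul0n; lia.
- apply: cg_sym; have -> : (v1 = a1 + b1 + (v1 - (a1 + b1)))%N by lia.
  apply: cg_trans (cg_x _ _ _) _; apply: cg_sym.
  by apply: (IHn 0%N s t); rewrite ?mul0n; lia.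
- have -> : (u1 = a1 + b1 + (u1 - (a1 + b1)))%N by lia.
  apply: cg_trans (cg_x _ _ _) _.
  by apply: (IHn r 0%N 0%N); rewrite ?mul0n; lia.
- apply: cg_sym; have -> : (v2 = a2 + b2 + (v2 - (a2 + b2)))%N by lia.
  apply: cg_trans (cg_y _ _ _) _; apply: cg_sym.
  by apply: (IHn r 0%N t); rewrite ?mul0n; lia.
- apply: cg_sym; have -> : (v3 = a3 + b3 + (v3 - (a3 + b3)))%N by lia.
  apply: cg_trans (cg_z _ _ _) _; apply: cg_sym.
  by apply: (IHn r s 0%N); rewrite ?mul0n; lia.
- by apply: (IHn r s t); lia.
Qed.

End LatticeCongruence.

(** * Detecting the lattice by residues and degree *)

Lemma eqr_nat_Zp m x y : (1 < m)%N ->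
  (x%:R == y%:R :> 'Z_m) = (x == y %[mod m])%N.
Proof. by move=> m_gt1; rewrite -val_eqE /= !val_Zp_nat. Qed.

(** On the exponent differences of the second and third generators, [(alpha, beta)] is [(m, 0)] and
    [(0, m)], so quotients by [m] recover the multiplicities. *)
Lemma lattice_kernel (a1 a2 a3 b1 b2 b3 m u1 u2 u3 v1 v2 v3 : nat) :
  let alpha y z := ((a3 + b3) * y + a2 * z)%N in
  let beta y z := (b3 * y + (a2 + b2) * z)%N in
  (0 < m)%N -> m = (a2 * a3 + b2 * a3 + b2 * b3)%N ->
  (alpha u2 u3 = alpha v2 v3 %[mod m])%N ->
  (beta u2 u3 = beta v2 v3 %[mod m])%N ->
  (m * u1 + a1 * alpha u2 u3 + b1 * beta u2 u3 =
   m * v1 + a1 * alpha v2 v3 + b1 * beta v2 v3)%N ->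
  exists r s t : nat,
  [/\ u1 + s * a1 + t * b1 = v1 + r * (a1 + b1),
      u2 + r * b2 + t * a2 = v2 + s * (a2 + b2) &
      u3 + r * a3 + s * b3 = v3 + t * (a3 + b3)]%N.
Proof.
move=> alpha beta m_gt0 mE eq_alpha eq_beta eq_deg.
have := divn_eq (alpha u2 u3) m; have := divn_eq (alpha v2 v3) m.
have := divn_eq (beta u2 u3) m; have := divn_eq (beta v2 v3) m.
rewrite eq_alpha eq_beta.
move: eq_deg; rewrite /alpha /beta => {eq_alpha eq_beta}.
move: (_ %/ m)%N (_ %/ m)%N (_ %/ m)%N (_ %/ m)%N (_ %% m)%N (_ %% m)%N.
move=> q1 q2 q3 q4 r1 r2 eq_deg e1 e2 e3 e4.
(* Cramer gives [s - r = q1 - q2] and [t - r = q3 - q4]; a common shift makes all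
   three natural numbers. *)
exists (q2 + q4)%N, (q1 + q4)%N, (q2 + q3)%N; split; apply/eqP.
- rewrite -(eqn_pmul2l m_gt0); apply/eqP.
  by rewrite e1 e2 e3 e4 in eq_deg; lia.
- rewrite -(eqn_pmul2l m_gt0); apply/eqP.
  (* Elimination by [(a2 + b2) * alpha - a2 * beta = m * u2], with the products supplied to
     [lia]. *)
  have f1 := congr1 (muln a2) e1; have f2 := congr1 (muln a2) e2.
  have f3 := congr1 (muln (a2 + b2)) e3; have f4 := congr1 (muln (a2 + b2)) e4.
  have g1 := congr1 (muln u2) mE; have g2 := congr1 (muln v2) mE.
  by clear -f1 f2 f3 f4 g1 g2; lia.
- rewrite -(eqn_pmul2l m_gt0); apply/eqP.
  (* Likewise [(a3 + b3) * beta - b3 * alpha = m * u3]. *)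
  have f1 := congr1 (muln (a3 + b3)) e1; have f2 := congr1 (muln (a3 + b3)) e2.
  have f3 := congr1 (muln b3) e3; have f4 := congr1 (muln b3) e4.
  have g1 := congr1 (muln u3) mE; have g2 := congr1 (muln v3) mE.
  by clear -f1 f2 f3 f4 g1 g2; lia.
Qed.

(* This makes [U * V] a [finZmodType], an instance MathComp does not declare. *)
HB.instance Definition _ (U V : finZmodType) := GRing.Zmodule.on (U * V)%type.

Theorem theorem9p1 (a b : 'I_3 -> nat)
    (ha : forall i : 'I_3, (0 < a i)%N) (hb : forall i : 'I_3, (0 < b i)%N) :
  exists N : nat, forall k : fieldType, char_zero_or_gt k N ->
    forall f : {mpoly k[3]}, radical (HN_ideal k a b) f <-> HN_ideal k a b f.
Proof.
have [m mE] : {m | m = a i2 * a i3 + b i2 * a i3 + b i2 * b i3}%N by eexists.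
(* ['Z_m] is the integers modulo [m] only for [m > 1]. *)
have m_gt1 : (1 < m)%N.
  have h1 : (0 < a i2 * a i3)%N by rewrite muln_gt0 !ha.
  have h2 : (0 < b i2 * a i3)%N by rewrite muln_gt0 ha hb.
  by rewrite mE; lia.
(* A prime above [m] cannot divide [m], so [N = m] makes [m] invertible in [k]. *)
exists m => k chark f; split=> [|fI]; last by exists 1%N; rewrite ?expr1.
have m_neq0 : m%:R != 0 :> k.
  case: chark => [/pcharf0P -> | [p pk lt_mp]]; first by rewrite -lt0n ltnW.
  rewrite -(dvdn_pcharf pk); apply/negP => /(dvdn_leq (ltnW m_gt1)).
  by rewrite leqNgt lt_mp.
pose alpha (u : 'X_{1..3}) := ((a i3 + b i3) * u i2 + a i2 * u i3)%N.
pose beta (u : 'X_{1..3}) := (b i3 * u i2 + (a i2 + b i2) * u i3)%N.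
pose cl u : ('Z_m * 'Z_m)%type := ((alpha u)%:R, (beta u)%:R).
pose dg (u : 'X_{1..3}) := (m * u i1 + a i1 * alpha u + b i1 * beta u)%N.
have clD : {morph cl : u v / (u + v)%MM >-> u + v}.
  move=> u v; congr (_, _); rewrite -natrD; congr _%:R.
    by rewrite /alpha !mnmDE; lia.
  by rewrite /beta !mnmDE; lia.
have dgD : {morph dg : u v / (u + v)%MM >-> (u + v)%N}.
  by move=> u v; rewrite /dg /alpha /beta !mnmDE; lia.
have binomials v w : cl v = cl w -> dg v = dg w ->
    HN_ideal k a b ('X_[v] - 'X_[w]).
  move=> /eqP; rewrite xpair_eqE !eqr_nat_Zp // => /andP[/eqP eqa /eqP eqb] eqd.
  have [r [s [t [e1 e2 e3]]]] := lattice_kernel (ltnW m_gt1) mE eqa eqb eqd.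
  have XE (u : 'X_{1..3}) :
      'X_[u] = 'X_i1 ^+ u i1 * 'X_i2 ^+ u i2 * 'X_i3 ^+ u i3 :> {mpoly k[3]}.
    rewrite mpolyXE_id !big_ord_recl big_ord0 mulr1 mulrA.
    by congr ('X_ _ ^+ u _ * 'X_ _ ^+ u _ * 'X_ _ ^+ u _); apply: val_inj.
  rewrite (XE v) (XE w); apply: lattice_congruence e1 e2 e3.
  - exact: ideal_gen0.
  - exact: ideal_genD.
  - exact: ideal_genM.
  - exact: (@ideal_gen_nth _ (HN_gens k a b) 0).
  - exact: (@ideal_gen_nth _ (HN_gens k a b) 1).
  - exact: (@ideal_gen_nth _ (HN_gens k a b) 2).
have parts0 g : HN_ideal k a b g -> forall h, class_part cl dg h g = 0.
  case=> u -> h; rewrite linear_sum big1 // => i _ /=.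
  have cl_eq v w s s' t t' : (s * m + alpha v = s' * m + alpha w)%N ->
      (t * m + beta v = t' * m + beta w)%N -> cl v = cl w.
    move=> /(congr1 (modn^~ m)) /= + /(congr1 (modn^~ m)) /=.
    rewrite !modnMDl => eqa eqb; apply/eqP.
    by rewrite xpair_eqE !eqr_nat_Zp // eqa eqb !eqxx.
  (* Between the two monomials of each generator, [(alpha, beta)] differs by [(-m, -m)], [(m, 0)]
     and [(0, m)] respectively; hence the arguments of [cl_eq]. *)
  case: i => [[|[|[|//]]] lti] /=; rewrite !mpolyXn -mpolyXD;
    apply: class_part_binomial => //;
    [ apply: (cl_eq _ _ 1 0 1 0)%N | | apply: (cl_eq _ _ 0 1 0 0)%N |
    | apply: (cl_eq _ _ 0 0 0 1)%N | ];
    by rewrite /dg /alpha /beta !mnmDE !mulmnE !mnm1E /=; lia.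
apply: ideal_gen_sqrt_closed => g /parts0 g2_0.
apply: (class_part0_mem binomials); apply: convolution_sqr0.
  rewrite card_prod card_ord Zp_cast // natrM mulf_neq0 //;
    by rewrite -polyC_natr polyC_eq0.
by move=> h; rewrite -class_partM.
Qed.
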